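(* Let $\mathbb{K}$ be a field and $S$ a polynomial ring over $\mathbb{K}$ in finitely many variables. Let $I \subset S$ be a monomial ideal with $L_I \cong \mathcal{L}(\Delta)$ for some $(p-1)$-dimensional stoss complex $\Delta$ on $k$ vertices. Then the Scarf complex of $I$ equals $\Delta$ (under the identification of the minimal generators of $I$ with the vertices of $\Delta$ given by the isomorphism $L_I\cong\mathcal{L}(\Delta)$ on atoms), and $I$ has a simplicial minimal free resolution supported on $\Delta$. In particular, the projective dimension of $S/I$ is $p$ and its Betti numbers are given by $$\beta^S_{i}(S/I) = \begin{cases}\binom{k}{i} &\text{ for } 0 \leq i < p, \\ \binom{k-1}{i-1} &\text{ for } i = p, \\ 0 &\text{ for } i > p.\end{cases}$$
   Context: Monomial ideals are nonzero and proper. $L_I$ is the lattice of all least common multiples of subsets of the minimal monomial generators of $I$ (the empty subset giving the minimal element), ordered by divisibility; its atoms are the minimal generators. $\beta_i^S(S/I)=\dim_{\mathbb{K}}\operatorname{Tor}_i^S(S/I,\mathbb{K})$. Scarf complex of $I$ with minimal generators $m_1,\dots,m_k$: $\Delta_I=\{\sigma\subseteq[k] : m_\sigma=m_\tau\Rightarrow\sigma=\tau \text{ for all } \tau\subseteq[k]\}$, where $m_\sigma=\operatorname{lcm}(m_i : i\in\sigma)$. A simplicial resolution supported on a complex $\Delta$ with vertex set $[k]$ is the (multigraded) cellular free complex obtained by labelling each face $\sigma$ of $\Delta$ by $m_\sigma$ and homogenizing the augmented simplicial chain complex of $\Delta$; it is a resolution of $S/I$ having the face $\sigma$ in homological degree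 $|\sigma|$. Stoss complex: a $d$-dimensional simplicial complex $\Delta$ with vertex set $[k]$ is a stoss complex if it has a complete $(d-1)$-skeleton (every subset of $[k]$ with at most $d$ elements is a face) and is $\mathbb{K}$-acyclic (all reduced homology over $\mathbb{K}$ vanishes). $\mathcal{L}(\Delta):=\{V\subseteq[k] : \Delta|_V\text{ is }\mathbb{K}\text{-acyclic}\}$ ordered by inclusion, where $\Delta|_V$ is the restriction to $V$ and by convention $\emptyset\in\mathcal{L}(\Delta)$; it is a finite lattice. *)

(* Defs.v *)
From mathcomp Require Import all_boot all_order all_algebra.
From mathcomp Require Export ring_quotient mpoly.

Set Implicit Arguments.
Unset Strict Implicit.
Unset Printing Implicit Defensive.

Import GRing.Theory.
Local Open Scope ring_scope.

(* Sequences of finite free modules R^(rk i), in homological degrees i >= 0.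
   Elements are row vectors and the map from degree i+1 to degree i is
   v |-> v *m diff i. The condition diff i.+1 *m diff i = 0 is not built in; it
   holds for the boundary matrices of a simplicial complex and is part of
   [resolution] below. *)
Record matrix_complex (R : nzRingType) := MatrixComplex {
  rk : nat -> nat;
  diff : forall i : nat, 'M[R]_(rk i.+1, rk i)
}.

Definition cycle_dim (K : fieldType) (C : matrix_complex K) (i : nat) : nat :=
  match i with
  | 0 => rk C 0
  | j.+1 => \rank (kermx (diff C j))
  end.

Definition homology_dim (K : fieldType) (C : matrix_complex K) (i : nat) : nat :=
  (cycle_dim C i - \rank (diff C i))%N.

Section SimplicialComplexes.
Variable k : nat.
Implicit Types (s t V : {set 'I_k}) (Delta : {set {set 'I_k}}).

Definition simplicial_complex Delta : Prop :=
  [/\ set0 \in Delta,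
      forall v : 'I_k, [set v] \in Delta
    & forall s t, s \in Delta -> t \subset s -> t \in Delta].

Definition faces Delta (i : nat) : {set {set 'I_k}} :=
  [set s in Delta | #|s| == i].

Definition restriction Delta V : {set {set 'I_k}} :=
  [set s in Delta | s \subset V].

(* If t = s \ {v}, the sign is (-1)^j where j is the number of w in s with w < v. *)
Definition incidence (R : nzRingType) s t : R :=
  if (t \subset s) && (#|s| == #|t|.+1)
  then (-1) ^+ #|[set w in s | [exists v in s :\: t, (w < v)%N]]|
  else 0.

Definition face_complex (R : nzRingType) Delta
    (c : {set 'I_k} -> {set 'I_k} -> R) : matrix_complex R :=
  @MatrixComplex R (fun i => #|faces Delta i|)
    (fun i => \matrix_(a, b) c (enum_val a) (enum_val b)).

(* The augmented chain complex, indexed so that a face s lies in degree #|s|;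
   its homology in degree i is the reduced homology in degree i - 1. *)
Definition augmented_chain_complex (K : fieldType) Delta : matrix_complex K :=
  face_complex Delta (@incidence K).

Definition acyclic (K : fieldType) Delta : Prop :=
  forall i : nat, homology_dim (augmented_chain_complex K Delta) i = 0%N.

Definition dimension Delta : int := (\max_(s in Delta) #|s|)%:Z - 1.

Definition stoss_complex (K : fieldType) Delta (d : int) : Prop :=
  [/\ simplicial_complex Delta,
      dimension Delta = d,
      forall s, #|s|%:Z <= d -> s \in Delta
    & acyclic K Delta].

Definition acyclic_lattice (K : fieldType) Delta V : Prop :=
  V = set0 \/ acyclic K (restriction Delta V).

End SimplicialComplexes.

Section MonomialIdeals.
Variables (K : fieldType) (n : nat).
Local Notation S := {mpoly K[n]}.
Implicit Types (I : {pred S}) (u g h : 'X_{1..n}).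

Definition generated_by_monomials I : Prop :=
  exists G : 'X_{1..n} -> Prop, forall p : S,
    p \in I <->
    exists2 r : seq (S * 'X_{1..n}),
      (forall t, t \in r -> G t.2) & p = \sum_(t <- r) t.1 * 'X_[t.2].

(* [idealr_closed] includes that the ideal is proper. *)
Definition monomial_ideal I : Prop :=
  [/\ idealr_closed I, exists2 p : S, p \in I & p != 0
    & generated_by_monomials I].

Definition minimal_generator I g : Prop :=
  'X_[g] \in I /\ forall h, (h <= g)%MM -> 'X_[h] \in I -> h = g.

Definition lcm_lattice I u : Prop :=
  exists2 r : seq 'X_{1..n},
    (forall g, g \in r -> minimal_generator I g)
    & u = \big[@mlcm n/0%MM]_(g <- r) g.

Definition lattice_isomorphism (k : nat) (Delta : {set {set 'I_k}}) I
    (f : {set 'I_k} -> 'X_{1..n}) : Prop :=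
  [/\ forall V, acyclic_lattice K Delta V -> lcm_lattice I (f V),
      forall u, lcm_lattice I u ->
        exists2 V, acyclic_lattice K Delta V & f V = u
    & forall V W, acyclic_lattice K Delta V -> acyclic_lattice K Delta W ->
        (f V <= f W)%MM = (V \subset W)].

Definition enumerates_minimal_generators (k : nat) I
    (m : 'I_k -> 'X_{1..n}) : Prop :=
  injective m /\ forall g, minimal_generator I g <-> exists v, g = m v.

Definition label (k : nat) (m : 'I_k -> 'X_{1..n}) (s : {set 'I_k}) :
    'X_{1..n} :=
  \big[@mlcm n/0%MM]_(v in s) m v.

Definition scarf_complex (k : nat) (m : 'I_k -> 'X_{1..n}) : {set {set 'I_k}} :=
  [set s | [forall t, (label m s == label m t) ==> (s == t)]].

Definition supported_complex (k : nat) (m : 'I_k -> 'X_{1..n})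
    (Delta : {set {set 'I_k}}) : matrix_complex S :=
  face_complex Delta
    (fun s t => incidence S s t * 'X_[(label m s - label m t)%MM]).

(* A resolution ... -> P 1 -> P 0 -> S/I -> 0. The augmentation P 0 -> S/I is
   given by a linear lift e : P 0 -> S, which exists whenever P 0 is
   projective; surjectivity and exactness at P 0 are stated modulo I. *)
Definition resolution I (P : nat -> lmodType S)
    (d : forall i : nat, P i.+1 -> P i) (e : P 0%N -> S) : Prop :=
  [/\ scalar e /\ (forall i, linear (d i)),
      forall q : S, exists x, q - e x \in I,
      forall x, e x \in I <-> exists y, x = d 0%N y
    & forall i x, d i x = 0 <-> exists y, x = d i.+1 y].

Definition free_resolution I (C : matrix_complex S) (a : 'cV[S]_(rk C 0)) :
    Prop :=
  @resolution I (fun i => 'rV[S]_(rk C i)) (fun i v => v *m diff C i)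
    (fun v => (v *m a) 0 0).

(* The entries of the differentials lie in the ideal generated by the
   variables. *)
Definition minimal_complex (C : matrix_complex S) : Prop :=
  forall i a b, (diff C i a b)@_0%MM = 0.

(* C (x)_S K, where K = S/(x_1, ..., x_n): taking the constant coefficient is
   the ring morphism S -> K. *)
Definition tensor_residue_field (C : matrix_complex S) : matrix_complex K :=
  MatrixComplex (fun i => map_mx (fun q : S => q@_0%MM) (diff C i)).

(* dim_K Tor_i^S(S/I, K) = b. Tor is computed from any resolution of S/I by
   finitely generated free modules; it is required that one exists and that all
   of them give b. *)
Definition has_betti_number I (i b : nat) : Prop :=
  (exists (C : matrix_complex S) a, @free_resolution I C a) /\
  (forall (C : matrix_complex S) a, @free_resolution I C a ->
     homology_dim (tensor_residue_field C) i = b).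

Definition projective (P : lmodType S) : Prop :=
  forall (M N : lmodType S) (g : {linear M -> N}) (h : {linear P -> N}),
    (forall y, exists x, g x = y) ->
    exists h' : {linear P -> M}, forall x, g (h' x) = h x.

Definition projdim_le I (q : nat) : Prop :=
  exists (P : nat -> lmodType S) (d : forall i, P i.+1 -> P i) (e : P 0%N -> S),
    [/\ resolution I d e, forall i, projective (P i)
      & forall i, (q < i)%N -> forall x : P i, x = 0].

Definition has_projdim I (q : nat) : Prop :=
  projdim_le I q /\ forall r, projdim_le I r -> (q <= r)%N.

End MonomialIdeals.

(* Main.v *)
(* The crux is that the closed sets {v | m_v divides u} of vertices are exactly
   the members of the lattice of acyclic vertex sets. So the degree-u strand of
   the complex supported on Delta is the augmented chain complex of an acyclic
   restriction of Delta, which gives exactness. It is minimal because faces lie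
   in the lattice, so that distinct faces have distinct labels. A nonface s is
   not in the Scarf complex: else s and all s \ v would lie in the lattice, and
   since the number of p-faces of an acyclic restriction of a stoss complex
   depends only on the number of vertices, counting the p-faces of Delta|_s that
   avoid a vertex in two ways would give a contradiction. Betti numbers and
   projective dimension follow by comparing projective resolutions and reducing
   modulo the variables. *)
From HB Require Import structures.
Require Import Defs.
From mathcomp Require Import all_boot all_order all_algebra.
From Stdlib Require Import Classical ClassicalEpsilon.

Set Implicit Arguments.
Unset Strict Implicit.
Unset Printing Implicit Defensive.

Import Order.TTheory GRing.Theory Num.Theory.
Local Open Scope ring_scope.

(** * Comparison of projective resolutions *)

Section Submodule.
Variables (R : nzRingType) (V : lmodType R) (T : {pred V}).
Hypothesis T_sub : submod_closed T.

(* The unused argument makes [T_pred T_sub] a key from which the closure proof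
   can be inferred. *)
Let T_pred (_ : submod_closed T) : {pred V} := T.
HB.instance Definition _ := GRing.isSubmodClosed.Build R V (T_pred T_sub) T_sub.

Record submodule := Submodule { submodule_val : V; _ : submodule_val \in T_pred T_sub }.
HB.instance Definition _ := [isSub for submodule_val].
HB.instance Definition _ := [Choice of submodule by <:].
HB.instance Definition _ := [SubChoice_isSubLmodule of submodule by <:].

End Submodule.

(** Chain maps and homotopies are built degree by degree, each component in its own type [A i]. The
    invariant [ok] is what makes the next component exist. *)
Lemma dependent_choice (A : nat -> Type) (ok : forall i, A i -> Prop)
    (next : forall i, A i -> A i.+1 -> Prop) :
    (exists a, ok 0%N a) ->
    (forall i a, ok i a -> exists b, next i a b /\ ok i.+1 b) ->
  exists f : forall i, A i,
    ok 0%N (f 0%N) /\ forall i, next i (f i) (f i.+1).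
Proof.
move=> /constructive_indefinite_description[a0 ok0] step.
pose st i := {a : A i | ok i a}.
pose s i (a : st i) : st i.+1 :=
  let h := constructive_indefinite_description _ (step i _ (svalP a)) in
  exist _ (sval h) (svalP h).2.
pose f := fix f i : st i :=
  if i is j.+1 then s j (f j) else exist _ a0 ok0.
exists (fun i => sval (f i)); split=> // i /=.
by case: constructive_indefinite_description => b [].
Qed.

Lemma linear_fun0 (R : nzRingType) (U V : lmodType R) (f : U -> V) :
  linear f -> f 0 = 0.
Proof. by move=> /(_ (-1) 0 0); rewrite scaler0 addr0 scaleN1r addNr. Qed.

Lemma linear_funB (R : nzRingType) (U V : lmodType R) (f : U -> V) u v :
  linear f -> f (u - v) = f u - f v.
Proof. by move=> f_lin; rewrite -scaleN1r addrC f_lin scaleN1r addrC. Qed.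

(** * Lifting through projective modules, chain maps and homotopies *)

Section Projective.
Variables (K : fieldType) (n : nat).
Local Notation S := {mpoly K[n]}.
Implicit Types (P Q : lmodType S).

(* A section of the projection T -> P, applied to P itself, replaces lifting
   along a surjection onto a submodule or a quotient of another module. *)
Lemma projective_section P Q (T : {pred Q * P}) :
    projective P -> submod_closed T -> (forall x, exists y, (y, x) \in T) ->
  exists h : {linear P -> Q}, forall x, (h x, x) \in T.
Proof.
move=> projP T_sub T_surj.
pose M : lmodType S := submodule T_sub.
pose g (z : M) : P := (val z).2.
have g_lin : linear g by move=> a u v; rewrite /g linearP.
pose gL := GRing.isLinear.Build _ _ _ _ g g_lin.
pose gl : {linear M -> P} := HB.pack g gL.
have [|h hP] := projP M P gl idfun.
  move=> x; have [y Tyx] := T_surj x.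
  by exists (Submodule Tyx).
pose h' (x : P) : Q := (val (h x)).1.
have h'_lin : linear h' by move=> a u v; rewrite /h' !linearP.
pose h'l : {linear P -> Q} := HB.pack h' (GRing.isLinear.Build _ _ _ _ h' h'_lin).
exists h'l => x; rewrite /= -[X in (_, X)](hP x) /=.
by have := valP (h x); rewrite /h' /g; case: (val _).
Qed.

(** The fibre product of [f] and [g] projects onto [P] because every value of [f] is a value of [g];
    the first component of a section is the lift. *)
Lemma projective_lift P Q (V : lmodType S) (f : P -> V) (g : Q -> V) :
    projective P -> linear f -> linear g -> (forall x, exists y, f x = g y) ->
  exists h : {linear P -> Q}, forall x, f x = g (h x).
Proof.
move=> projP f_lin g_lin im_f.
pose T : {pred Q * P} := [pred z | f z.2 == g z.1].
have [||h hP] := @projective_section P Q T projP.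
- split; first by rewrite inE /= !linear_fun0.
  move=> a u v; rewrite !inE /= => /eqP fu /eqP fv.
  by rewrite f_lin g_lin fu fv.
- by move=> x; have [y fx] := im_f x; exists y; rewrite inE fx.
by exists h => x; have /eqP := hP x.
Qed.

Lemma projective_rV m : projective ('rV[S]_m : lmodType S).
Proof.
move=> M N g h g_surj.
have [y yP] := fin_all_exists (fun j : 'I_m => g_surj (h (delta_mx 0 j))).
pose h' (v : 'rV[S]_m) : M := \sum_j v 0 j *: y j.
have h'_lin : linear h'.
  move=> a u v; rewrite /h' scaler_sumr -big_split /=.
  by apply: eq_bigr => j _; rewrite !mxE scalerDl scalerA.
pose hl : {linear 'rV[S]_m -> M} := HB.pack h' (GRing.isLinear.Build _ _ _ _ h' h'_lin).
exists hl => x /=.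
rewrite [in RHS](row_sum_delta x) /h' !linear_sum /=.
by apply: eq_bigr => j _; rewrite !linearZ /= yP.
Qed.

Variable I : {pred S}.
Hypothesis I_ideal : idealr_closed I.

Lemma ideal_comb a u v : u \in I -> v \in I -> a * u + v \in I.
Proof. by case: I_ideal => _ _; apply. Qed.

Lemma ideal0 : 0 \in I. Proof. by case: I_ideal. Qed.

Lemma idealD u v : u \in I -> v \in I -> u + v \in I.
Proof. by move=> uI vI; rewrite -[u]mul1r ideal_comb. Qed.

Lemma idealM a u : u \in I -> a * u \in I.
Proof. by move=> uI; rewrite -[_ * u]addr0 ideal_comb // ideal0. Qed.

Lemma idealN u : u \in I -> - u \in I.
Proof. by move=> uI; rewrite -mulN1r idealM. Qed.

Section Lifting.
Variables (P : nat -> lmodType S) (d : forall i, P i.+1 -> P i) (e : P 0%N -> S).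
Variables (Q : nat -> lmodType S) (d' : forall i, Q i.+1 -> Q i) (e' : Q 0%N -> S).
Hypothesis resP : resolution I d e.
Hypothesis resQ : resolution I d' e'.
Hypothesis projP : forall i, projective (P i).

Lemma chain_map_exists :
  exists phi : forall i, {linear P i -> Q i},
    (forall x, e x - e' (phi 0%N x) \in I) /\
    forall i x, phi i (d x) = d' (phi i.+1 x).
Proof.
have [[e_sc d_lin] _ eP dP] := resP; have [[e'_sc d'_lin] e'_surj e'P d'P] := resQ.
(* Sending boundaries to boundaries is exactly what allows the lift in the next degree. Degree 0
   also records compatibility with the augmentations, which holds only modulo [I]. *)
pose ok i (h : {linear P i -> Q i}) :=
  (forall x, exists y, h (d x) = d' y) /\
  (if i is 0%N then fun h : {linear P 0%N -> Q 0%N} =>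
     forall x, e x - e' (h x) \in I else fun=> True) h.
have [||phi [[_ phi0] phiS]] := @dependent_choice _ ok
  (fun i a b => forall x, a (d x) = d' (b x)).
- pose T : {pred Q 0%N * P 0%N} := [pred z | e z.2 - e' z.1 \in I].
  have [||h hP] := @projective_section _ _ T (@projP 0%N).
  + split.
      rewrite inE /=.
      have -> : e 0 = 0.
        by have := e_sc (-1) 0 0; rewrite scaler0 addr0 mulN1r addNr.
      have -> : e' 0 = 0.
        by have := e'_sc (-1) 0 0; rewrite scaler0 addr0 mulN1r addNr.
      by rewrite subr0 ideal0.
    move=> a u v; rewrite !inE /= => uT vT.
    by rewrite e_sc e'_sc opprD addrACA -mulrBr ideal_comb.
  + by move=> x; have [y] := e'_surj (e x); exists y.
  exists h; split=> // x; apply/e'P.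
  have /eP dxI : exists y, d x = d y by exists x.
  have -> : e' (h (d x)) = e (d x) - (e (d x) - e' (h (d x))) by rewrite subKr.
  by apply: idealD => //; apply: idealN; apply: (hP (d x)).
- move=> i h [im_h _].
  have hd_lin : linear (fun x => h (d x)) by move=> a u v; rewrite d_lin linearP.
  have [b bP] := projective_lift (@projP i.+1) hd_lin (d'_lin i) im_h.
  exists b; split=> //; split=> // x; apply/d'P; rewrite -bP.
  have /dP -> : exists y, d x = d y by exists x.
  by rewrite raddf0.
by exists phi.
Qed.

Lemma null_homotopy_exists (theta : forall i, {linear P i -> Q i}) :
    (forall x, e' (theta 0%N x) \in I) ->
    (forall i x, theta i (d x) = d' (theta i.+1 x)) ->
  exists h : forall i, {linear P i -> Q i.+1},
    (forall x, theta 0%N x = d' (h 0%N x)) /\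
    forall i x, theta i.+1 x = h i (d x) + d' (h i.+1 x).
Proof.
have [[e_sc d_lin] _ eP dP] := resP; have [[e'_sc d'_lin] e'_surj e'P d'P] := resQ.
move=> theta0 thetaS.
(* If [theta i] and [d' \o h] agree on boundaries, then [theta i.+1 x - h (d x)] is a cycle, hence a
   boundary, and can be lifted along [d']. *)
pose ok i (h : {linear P i -> Q i.+1}) :=
  (forall x : P i.+1, theta i (d x) = d' (h (d x))) /\
  (if i is 0%N then fun h : {linear P 0%N -> Q 1%N} =>
     forall x, theta 0%N x = d' (h x) else fun=> True) h.
have [||h [[_ h0] hS]] := @dependent_choice _ ok
  (fun i a b => forall x, theta i.+1 x = a (d x) + d' (b x)).
- have th_lin : linear (theta 0%N) by exact: linearP.
  have [|h hP] := projective_lift (@projP 0%N) th_lin (d'_lin 0%N).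
    by move=> x; apply/e'P.
  by exists h; split=> [x|]; [rewrite hP | exact: hP].
- move=> i h [im_h _].
  have th_lin : linear (fun x => theta i.+1 x - h (d x)).
    by move=> a u v; rewrite d_lin (linearP h) (linearP (theta i.+1)) opprD addrACA -scalerBr.
  have [|b bP] := projective_lift (@projP i.+1) th_lin (d'_lin i.+1).
    move=> x; apply/d'P; rewrite (linear_funB _ _ (d'_lin i)).
    by rewrite -thetaS im_h subrr.
  have {}bP x : theta i.+1 x = h (d x) + d' (b x) by rewrite -bP addrC subrK.
  exists b; split=> //; split=> // x; rewrite bP.
  have /dP -> : exists y, d x = d y by exists x.
  by rewrite raddf0 add0r.
by exists h.
Qed.

End Lifting.

Lemma comparison_homotopy (P Q : nat -> lmodType S)
    (d : forall i, P i.+1 -> P i) (e : P 0%N -> S)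
    (d' : forall i, Q i.+1 -> Q i) (e' : Q 0%N -> S) :
    resolution I d e -> resolution I d' e' ->
    (forall i, projective (P i)) -> (forall i, projective (Q i)) ->
  exists (phi : forall i, {linear P i -> Q i}) (psi : forall i, {linear Q i -> P i})
    (h : forall i, {linear P i -> P i.+1}),
    [/\ forall i x, phi i (d i x) = d' i (phi i.+1 x),
        forall i x, psi i (d' i x) = d i (psi i.+1 x),
        forall x, psi 0%N (phi 0%N x) - x = d 0%N (h 0%N x)
      & forall i x, psi i.+1 (phi i.+1 x) - x = h i (d i x) + d i.+1 (h i.+1 x)].
Proof.
move=> resP resQ projP projQ.
have [phi [phi0 phiS]] := chain_map_exists resP resQ projP.
have [psi [psi0 psiS]] := chain_map_exists resQ resP projQ.
have [[e_sc d_lin] _ _ _] := resP.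
have [||h [h0 hS]] := null_homotopy_exists resP resP projP
    (theta := fun i => (psi i \o phi i) \- idfun).
- move=> x /=; rewrite addrC -scaleN1r e_sc mulN1r addrC.
  have := idealN (idealD (phi0 x) (psi0 (phi 0%N x))).
  by rewrite addrA subrK opprB.
- by move=> i x /=; rewrite phiS psiS (linear_funB _ _ (d_lin i)).
by exists phi, psi, h.
Qed.

End Projective.

(** * Betti numbers and projective dimension *)

(** The map from Z to Z'/B' induced by F has its kernel inside B; rank-nullity for this map gives
    the bound. Multiplying by [cokermx B'] realizes the quotient by B'. *)
Lemma rank_subquotient_le (K : fieldType) (m m' q b q' b' : nat)
    (Z : 'M[K]_(q, m)) (B : 'M[K]_(b, m))
    (Z' : 'M[K]_(q', m')) (B' : 'M[K]_(b', m')) (F : 'M[K]_(m, m')) :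
    (B' <= Z')%MS -> (Z *m F <= Z')%MS ->
    (forall u : 'rV_m, (u <= Z)%MS -> (u *m F <= B')%MS -> (u <= B)%MS) ->
  (\rank Z - \rank B <= \rank Z' - \rank B')%N.
Proof.
move=> leBZ leZZ kerB.
have rkZ := mxrank_mul_ker Z (F *m cokermx B').
have rkZ' := mxrank_mul_ker Z' (cokermx B').
have leK : (\rank (Z :&: kermx (F *m cokermx B')) <= \rank B)%N.
  apply/mxrankS/rV_subP => u; rewrite sub_capmx => /andP[uZ /sub_kermxP uK].
  by apply: kerB => //; rewrite submxE -mulmxA uK.
have leB' : (\rank B' <= \rank (Z' :&: kermx (cokermx B')))%N.
  by apply: mxrankS; rewrite sub_capmx leBZ; apply/sub_kermxP; rewrite mulmx_coker.
have leW : (\rank (Z *m (F *m cokermx B')) <= \rank (Z' *m cokermx B'))%N.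
  by rewrite mulmxA; apply/mxrankS/submxMr.
rewrite leq_subLR -rkZ -rkZ' addnC leq_add // -addnBA //.
by rewrite (leq_trans leW) // leq_addr.
Qed.

(** Going to D by F and back by G is homotopic to the identity, so F is injective on homology. *)
Lemma homology_dim_retract (K : fieldType) (C D : matrix_complex K)
    (F : forall i, 'M[K]_(rk C i, rk D i)) (G : forall i, 'M[K]_(rk D i, rk C i))
    (H : forall i, 'M[K]_(rk C i, rk C i.+1)) :
    (forall i, diff D i.+1 *m diff D i = 0) ->
    (forall i, diff C i *m F i = F i.+1 *m diff D i) ->
    (forall i, diff D i *m G i = G i.+1 *m diff C i) ->
    F 0%N *m G 0%N - 1%:M = H 0%N *m diff C 0%N ->
    (forall i, F i.+1 *m G i.+1 - 1%:M =
       diff C i *m H i + H i.+1 *m diff C i.+1) ->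
  forall i, (homology_dim C i <= homology_dim D i)%N.
Proof.
move=> dD FE GE H0 HS [|i]; rewrite /homology_dim /=.
  rewrite -[X in (X - _)%N](mxrank1 K) -[X in (_ <= X - _)%N](mxrank1 K).
  apply: (@rank_subquotient_le _ _ _ _ _ _ _ _ _ _ _ (F 0%N)); try exact: submx1.
  move=> u _ /submxP[w uF].
  have -> : u = u *m F 0%N *m G 0%N - u *m (F 0%N *m G 0%N - 1%:M).
    by rewrite mulmxBr mulmx1 mulmxA opprB addrC subrK.
  rewrite uF H0 -mulmxA GE !mulmxA -mulmxBl.
  exact: submxMl.
apply: (@rank_subquotient_le _ _ _ _ _ _ _ _ _ _ _ (F i.+1)).
- by apply/sub_kermxP; rewrite dD.
- by apply/sub_kermxP; rewrite -mulmxA -FE mulmxA mulmx_ker mul0mx.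
move=> u /sub_kermxP uZ /submxP[w uF].
(* Both terms are boundaries: the first since [u *m F i.+1] is one and G is a chain map, the second
   by the homotopy, as [u] is a cycle. *)
have -> : u = u *m F i.+1 *m G i.+1 - u *m (F i.+1 *m G i.+1 - 1%:M).
  by rewrite mulmxBr mulmx1 mulmxA opprB addrC subrK.
rewrite uF HS mulmxDr [u *m (diff C i *m _)]mulmxA uZ mul0mx add0r.
by rewrite -mulmxA GE !mulmxA -mulmxBl submxMl.
Qed.

Lemma eq_mulrV (R : nzRingType) (m n : nat) (A B : 'M[R]_(m, n)) :
  (forall x : 'rV_m, x *m A = x *m B) -> A = B.
Proof. by move=> eqAB; apply/row_matrixP => i; rewrite !rowE. Qed.

(** * Reduction of free resolutions modulo the variables *)

Section FreeResolutions.
Variables (K : fieldType) (n : nat).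
Local Notation S := {mpoly K[n]}.
Variable I : {pred S}.
Hypothesis I_ideal : idealr_closed I.
Local Notation ev0 := (mcoeff 0%MM : S -> K).

Lemma free_resolution_comp0 (C : matrix_complex S) a :
  @free_resolution K n I C a -> forall i, diff C i.+1 *m diff C i = 0.
Proof.
case=> _ _ _ dC i; apply: eq_mulrV => x; rewrite mulmxA mulmx0.
by apply/dC; exists x.
Qed.

(** The comparison maps and the homotopy are matrices over S; taking constant coefficients is a ring
    morphism, so their identities survive over K. Exchanging C and D shows that the homology does
    not depend on the resolution. *)
Lemma betti_le (C D : matrix_complex S) a b i :
    @free_resolution K n I C a -> @free_resolution K n I D b ->
  (homology_dim (tensor_residue_field C) i
     <= homology_dim (tensor_residue_field D) i)%N.
Proof.
move=> resC resD.
have projC j := @projective_rV K n (rk C j).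
have projD j := @projective_rV K n (rk D j).
have [phi [psi [h [phiS psiS h0 hS]]]] :=
  comparison_homotopy I_ideal resC resD projC projD.
pose F j : 'M[K]_(rk C j, rk D j) := map_mx ev0 (lin1_mx (phi j)).
pose G j : 'M[K]_(rk D j, rk C j) := map_mx ev0 (lin1_mx (psi j)).
pose H j : 'M[K]_(rk C j, rk C j.+1) := map_mx ev0 (lin1_mx (h j)).
apply: (@homology_dim_retract _ (tensor_residue_field C) (tensor_residue_field D) F G H).
- by move=> j; rewrite -[LHS]map_mxM /= (free_resolution_comp0 resD) map_mx0.
- move=> j; rewrite -[LHS]map_mxM -[RHS]map_mxM; congr map_mx.
  by apply: eq_mulrV => x; rewrite !mulmxA !mul_rV_lin1; apply: phiS.
- move=> j; rewrite -[LHS]map_mxM -[RHS]map_mxM; congr map_mx.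
  by apply: eq_mulrV => x; rewrite !mulmxA !mul_rV_lin1; apply: psiS.
- rewrite -[_ *m G _]map_mxM -[RHS]map_mxM -(map_mx1 ev0) -map_mxB; congr map_mx.
  by apply: eq_mulrV => x; rewrite mulmxBr mulmx1 !mulmxA !mul_rV_lin1 -h0.
- move=> j; rewrite -[_ *m G _]map_mxM -(map_mx1 ev0) -map_mxB.
  rewrite -[X in _ = X + _]map_mxM -[X in _ = _ + X]map_mxM -map_mxD; congr map_mx.
  apply: eq_mulrV => x; rewrite mulmxBr mulmxDr mulmx1 !mulmxA !mul_rV_lin1.
  by rewrite -hS.
Qed.

Lemma tensor_minimal_complex (C : matrix_complex S) :
  minimal_complex C -> forall i, diff (tensor_residue_field C) i = 0.
Proof. by move=> minC i; apply/matrixP => a b; rewrite !mxE minC. Qed.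

(** Modulo the variables all differentials of D vanish, so each homology space is the whole
    module. *)
Lemma betti_minimal (D : matrix_complex S) a i :
    @free_resolution K n I D a -> minimal_complex D ->
  has_betti_number I i (rk D i).
Proof.
move=> resD minD.
have rkE : homology_dim (tensor_residue_field D) i = rk D i.
  have dD0 := tensor_minimal_complex minD.
  case: i => [|i]; rewrite /homology_dim /cycle_dim !dD0 ?mxrank_ker mxrank0.
    by rewrite subn0.
  by rewrite mxrank0 !subn0.
split=> [|C b resC]; first by exists D, a.
by apply/eqP; rewrite -rkE eqn_leq !(betti_le _ resC resD, betti_le _ resD resC).
Qed.

Lemma projdim_minimal (D : matrix_complex S) a q :
    @free_resolution K n I D a -> minimal_complex D ->
    (0 < rk D q)%N -> (forall i, (q < i)%N -> rk D i = 0%N) ->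
  has_projdim I q.
Proof.
move=> resD minD rkq rk0.
have projD j := @projective_rV K n (rk D j).
split.
  exists (fun i => 'rV[S]_(rk D i)), (fun i v => v *m diff D i), (fun v => (v *m a) 0 0).
  split=> // i /rk0 rki x; apply/rowP => j.
  by exfalso; move: (nat_of_ord j) (ltn_ord j) => t; rewrite rki.
move=> r [P [d [e [resP projP Pr]]]]; rewrite leqNgt; apply/negP => lt_rq.
have [phi [psi [h [_ _ _ hS]]]] := comparison_homotopy I_ideal resD resP projD projP.
case: q => // q in rkq rk0 lt_rq *.
(* The shorter resolution is zero in this degree, so the composite of the comparison maps is zero
   and minus the identity is null-homotopic. Modulo the variables the right side vanishes, but the
   left side does not. *)
have E : (- 1%:M : 'M[S]_(rk D q.+1)) =
    diff D q *m lin1_mx (h q) + lin1_mx (h q.+1) *m diff D q.+1.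
  apply: eq_mulrV => x; rewrite mulmxDr !mulmxA !mul_rV_lin1 -hS.
  by rewrite (Pr _ lt_rq (phi q.+1 x)) raddf0 sub0r mulmxN mulmx1.
have minD' j : map_mx ev0 (diff D j) = 0 by exact: tensor_minimal_complex.
have /(congr1 (map_mx ev0)) := E.
rewrite map_mxN map_mx1 map_mxD !map_mxM !minD' mul0mx mulmx0 addr0.
move/matrixP/(_ (Ordinal rkq) (Ordinal rkq)); rewrite !mxE eqxx => /eqP.
by rewrite oppr_eq0 oner_eq0.
Qed.

End FreeResolutions.

(** * Acyclic complexes *)

Section Incidence.
Variables (k : nat) (R : nzRingType).
Implicit Types (r s t : {set 'I_k}) (v w a b : 'I_k).

Local Notation inc := (@incidence k R).

Lemma incidence_eq0 s t : ~~ ((t \subset s) && (#|s| == #|t|.+1)) -> inc s t = 0.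
Proof. by rewrite /incidence => /negbTE ->. Qed.

Lemma incidence_sqr s t : t \subset s -> #|s| = #|t|.+1 -> inc s t * inc s t = 1.
Proof. by move=> ts st; rewrite /incidence ts st eqxx -expr2 sqrr_sign. Qed.

Lemma incidence_setU1 v t : v \notin t ->
  inc (v |: t) t = (-1) ^+ #|[set w in t | (w < v)%N]|.
Proof.
move=> vt; rewrite /incidence subsetUr cardsU1 vt eqxx /=; congr (_ ^+ _).
apply: eq_card => w; rewrite !inE.
have -> : [exists u in (v |: t) :\: t, (w < u)%N] = (w < v)%N.
  apply/existsP/idP => [[u]|wv].
    by rewrite !inE => /andP[/andP[/negbTE ut]]; rewrite ut orbF => /eqP ->.
  by exists v; rewrite !inE eqxx vt.
by have [->|] := eqVneq w v; rewrite // ltnn !andbF.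
Qed.

Lemma subset_card_succ s t : t \subset s -> #|s| = #|t|.+1 ->
  exists2 v, v \notin t & s = v |: t.
Proof.
move=> ts st.
have /cards1P[v stv] : #|s :\: t| == 1%N.
  by rewrite cardsD (setIidPr ts) st subSnn.
have : v \in s :\: t by rewrite stv set11.
by rewrite inE => /andP[vt vs]; exists v => //; rewrite -{1}(setID s t) (setIidPr ts) setUC stv.
Qed.

(** Only two sets lie strictly between [t] and [r = t + {a, b}], namely [a |: t] and [b |: t], and
    their contributions have opposite signs. *)
Lemma incidence_comp r t : \sum_s inc r s * inc s t = 0.
Proof.
have [/andP[tr /eqP rt]|nrt] := boolP ((t \subset r) && (#|r| == #|t|.+2)); last first.
  apply: big1 => s _.
  have [/andP[sr /eqP rs]|H] := boolP ((s \subset r) && (#|r| == #|s|.+1));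
    last by rewrite (incidence_eq0 H) mul0r.
  rewrite [inc s t]incidence_eq0 ?mulr0 //; apply: contra nrt => /andP[ts /eqP st].
  by rewrite (subset_trans ts sr) rs st /=.
have /cards2P[a [b [ab rtab]]] : #|r :\: t| == 2%N.
  by rewrite cardsD (setIidPr tr) rt subSn // subSnn.
have at_ : a \notin t.
  by have : a \in r :\: t; [rewrite rtab set21 | rewrite inE => /andP[]].
have bt : b \notin t.
  by have : b \in r :\: t; [rewrite rtab set22 | rewrite inE => /andP[]].
have rE : r = a |: (b |: t).
  by rewrite setUA -rtab -{1}(setID r t) (setIidPr tr) setUC.
have abt : a \notin b |: t by rewrite !inE negb_or ab at_.
have bat : b \notin a |: t by rewrite !inE negb_or eq_sym ab bt.
have neq : b |: t != a |: t.
  by apply: contra abt => /eqP ->; rewrite setU11.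
rewrite (bigD1 (a |: t)) //= (bigD1 (b |: t)) //= big1 ?addr0; last first.
  move=> s /andP[sa sb].
  have [/andP[ts /eqP st]|H] := boolP ((t \subset s) && (#|s| == #|t|.+1));
    last by rewrite (incidence_eq0 H) mulr0.
  have [sr|sr] := boolP (s \subset r);
    last by rewrite incidence_eq0 ?mul0r // (negbTE sr).
  have [v vt sE] := subset_card_succ ts st.
  have : v \in r :\: t by rewrite inE vt (subsetP sr) // sE setU11.
  by rewrite rtab !inE => /orP[] /eqP vE; move: sa sb; rewrite sE vE eqxx.
rewrite {1}rE setUCA !incidence_setU1 // rE incidence_setU1 //.
(* Inserting [u] shifts the position of [v] exactly when [u < v]; since just one of [a < b] and
   [b < a] holds, just one of the two products gains a sign. *)
have below u v : u \notin t ->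
    #|[set w in u |: t | (w < v)%N]| = ((u < v) + #|[set w in t | (w < v)%N]|)%N.
  move=> ut; case: ltnP => uv; last first.
    apply: eq_card => w; rewrite !inE; case: eqVneq => // ->.
    by rewrite ltnNge uv !andbF.
  rewrite -[RHS](_ : #|u |: [set w in t | (w < v)%N]| = _); last first.
    by rewrite cardsU1 inE (negbTE ut).
  by apply: eq_card => w; rewrite !inE; case: eqVneq => // ->; rewrite uv.
rewrite !below // -!exprD; case: ltngtP => [ltab|ltba|/val_inj eqab].
- by rewrite /= add1n addSn exprS mulN1r [X in _ ^+ X]addnC addNr.
- by rewrite /= add0n add1n addSn exprS mulN1r [X in _ ^+ X]addnC subrr.
- by rewrite eqab eqxx in ab.
Qed.

End Incidence.

(** * Chains as functions on sets *)

Section FaceComplexes.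
Variables (k : nat) (R : nzRingType) (X : {set {set 'I_k}}).
Variable c : {set 'I_k} -> {set 'I_k} -> R.
Implicit Types (s t : {set 'I_k}).

(** Replacing row vectors, indexed by enumerated faces, by functions on all vertex sets turns matrix
    products into sums over sets. *)
Lemma row_chain i (v : 'rV[R]_#|faces X i|) :
  exists g : {set 'I_k} -> R, forall a, v 0 a = g (enum_val a).
Proof.
exists (fun s => \sum_a v 0 a *+ (enum_val a == s)) => a.
rewrite (bigD1 a) //= eqxx big1 ?addr0 // => b ba.
by rewrite (inj_eq enum_val_inj) (negbTE ba).
Qed.

Lemma mul_row_diff i (v : 'rV[R]_#|faces X i.+1|) (g : {set 'I_k} -> R) b :
    (forall a, v 0 a = g (enum_val a)) ->
  (v *m diff (face_complex X c) i) 0 b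
    = \sum_(s in faces X i.+1) g s * c s (enum_val b).
Proof.
move=> vg; rewrite mxE [RHS]big_enum_val.
by apply: eq_bigr => a _; rewrite vg mxE.
Qed.

Lemma face_complex_comp0 i :
    (forall r t, r \in faces X i.+2 -> t \in faces X i ->
       \sum_(s in faces X i.+1) c r s * c s t = 0) ->
  diff (face_complex X c) i.+1 *m diff (face_complex X c) i = 0.
Proof.
move=> H; apply/matrixP => a b; rewrite !mxE /=.
rewrite -[RHS](H (enum_val a) (enum_val b)) ?enum_valP // [RHS]big_enum_val.
by apply: eq_bigr => s _; rewrite !mxE.
Qed.

End FaceComplexes.

(** * Exactness, rank counts and cones *)

Section Acyclic.
Variables (k : nat) (K : fieldType).
Implicit Types (s t r V : {set 'I_k}) (X : {set {set 'I_k}}).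
Local Notation inc := (@incidence k K).

Definition subset_closed X :=
  forall s t, s \in X -> t \subset s -> t \in X.

Lemma restriction_subset_closed X V :
  subset_closed X -> subset_closed (restriction X V).
Proof.
move=> Xsub s t; rewrite !inE => /andP[sX sV] ts.
by rewrite (Xsub s) // (subset_trans ts).
Qed.

(** A set with nonzero incidence to a face [r] is a facet of [r], hence itself a face; thus
    [incidence_comp] applies to sums over faces. *)
Lemma sum_faces_incidence (R : nzRingType) X i r t (F : {set 'I_k} -> R) :
    subset_closed X -> r \in faces X i.+1 ->
  \sum_(s in faces X i) @incidence k R r s * F s
    = \sum_s @incidence k R r s * F s.
Proof.
move=> Xsub; rewrite inE => /andP[rX /eqP ri].
rewrite [RHS](bigID (mem (faces X i))) /= [X in _ + X]big1 ?addr0 // => s.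
move=> sF; rewrite incidence_eq0 ?mul0r //; apply: contra sF => /andP[sr].
by rewrite ri eqSS inE eq_sym => ->; rewrite (Xsub r).
Qed.

Lemma augmented_comp0 X i : subset_closed X ->
  diff (augmented_chain_complex K X) i.+1 *m diff (augmented_chain_complex K X) i
    = 0.
Proof.
move=> Xsub; apply: face_complex_comp0 => r t rF tF.
by rewrite sum_faces_incidence // incidence_comp.
Qed.

Lemma acyclic_rank0 X : acyclic K X -> #|faces X 0| = \rank (diff (augmented_chain_complex K X) 0).
Proof.
move=> /(_ 0%N) /eqP; rewrite subn_eq0 => le; apply/eqP.
by rewrite eqn_leq le rank_leq_col.
Qed.

Lemma acyclic_kernel X i : subset_closed X -> acyclic K X ->
  (kermx (diff (augmented_chain_complex K X) i) == diff (augmented_chain_complex K X) i.+1)%MS.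
Proof.
move=> Xsub /(_ i.+1) /eqP; rewrite subn_eq0 => le.
have sub : (diff (augmented_chain_complex K X) i.+1 <=
            kermx (diff (augmented_chain_complex K X) i))%MS.
  by apply/sub_kermxP/augmented_comp0.
by rewrite sub andbT -(mxrank_leqif_sup sub) eqn_leq le mxrankS.
Qed.

Lemma acyclic_exact X i (g : {set 'I_k} -> K) :
    subset_closed X -> acyclic K X ->
    (forall t, t \in faces X i -> \sum_(s in faces X i.+1) g s * inc s t = 0) ->
  exists b, forall s, s \in faces X i.+1 ->
    g s = \sum_(r in faces X i.+2) b r * inc r s.
Proof.
move=> Xsub Xac cyc.
pose v : 'rV[K]_#|faces X i.+1| := \row_a g (enum_val a).
have vE a : v 0 a = g (enum_val a) by rewrite mxE.
have : (v <= kermx (diff (augmented_chain_complex K X) i))%MS.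
  apply/sub_kermxP/rowP => b; rewrite (mul_row_diff _ vE) mxE.
  exact/cyc/enum_valP.
rewrite (eqmxP (acyclic_kernel i Xsub Xac)) => /submxP[w vw].
have [b bE] := row_chain w; exists b => s sF.
have -> : s = enum_val (enum_rank_in sF s) by rewrite enum_rankK_in.
by rewrite -vE vw (mul_row_diff _ bE).
Qed.

Lemma card_faces_rank X i : subset_closed X -> acyclic K X ->
  (#|faces X i.+1| = \rank (diff (augmented_chain_complex K X) i)
    + \rank (diff (augmented_chain_complex K X) i.+1))%N.
Proof.
move=> Xsub Xac; rewrite -(eqmxP (acyclic_kernel i Xsub Xac)) mxrank_ker.
by rewrite subnKC // rank_leq_row.
Qed.

(* The cone over the faces avoiding the apex corrects any chain to one
   supported on faces containing the apex; the only such cycle is zero. *)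
Lemma acyclic_cone X v : subset_closed X -> (forall s, s \in X -> v |: s \in X) ->
  acyclic K X.
Proof.
move=> Xsub Xcone.
(* The cone with apex [v] over the part of [g] avoiding [v], signed so that its boundary restores
   [g] on faces avoiding [v]. *)
pose B (g : {set 'I_k} -> K) r := if v \in r then inc r (r :\ v) * g (r :\ v) else 0.
have BE g i s : s \in faces X i -> v \notin s ->
    \sum_(r in faces X i.+1) B g r * inc r s = g s.
  rewrite inE => /andP[sX /eqP si] vs.
  have vsF : v |: s \in faces X i.+1 by rewrite inE Xcone // cardsU1 vs si /=.
  rewrite (bigD1 (v |: s)) //= big1 ?addr0 => [|r /andP[_ rvs]].
    rewrite /B setU11 setU1K // mulrAC incidence_sqr ?mul1r ?subsetUr //.
    by rewrite cardsU1 vs.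
  rewrite /B; case: ifP => vr; last by rewrite mul0r.
  rewrite [inc r s]incidence_eq0 ?mulr0 //; apply: contra rvs => /andP[sr /eqP rs].
  have [w ws rE] := subset_card_succ sr rs.
  by move: vr; rewrite rE !inE (negbTE vs) orbF => /eqP ->.
have main i (g : {set 'I_k} -> K) :
    (if i is j.+1 then forall t, t \in faces X j ->
       \sum_(s in faces X i) g s * inc s t = 0 else True) ->
    forall s, s \in faces X i -> g s = \sum_(r in faces X i.+1) B g r * inc r s.
  move=> cyc s sF; case vs: (v \in s); last by rewrite BE // vs.
  case: i => [|j] in cyc sF *.
    by move: sF; rewrite inE cards_eq0 => /andP[_ /eqP s0]; rewrite s0 inE in vs.
  pose g' u := g u - \sum_(r in faces X j.+2) B g r * inc r u.
  have g'0 u : u \in faces X j.+1 -> v \notin u -> g' u = 0.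
    by move=> uF vu; rewrite /g' BE // subrr.
  have [sX /eqP sj] : s \in X /\ #|s| == j.+1 by move: sF; rewrite inE => /andP.
  have tj : #|s| = #|s :\ v|.+1 by rewrite (cardsD1 v s) vs.
  have tF : s :\ v \in faces X j.
    by rewrite inE (Xsub s) ?subsetDl //= -eqSS -tj sj.
  (* The difference [g'] is a cycle supported on faces containing [v]. Among these only [s] has
     [s :\ v] as a facet, so this coefficient of the boundary isolates [g' s]. *)
  have : \sum_(u in faces X j.+1) g' u * inc u (s :\ v) = 0.
    under eq_bigr => u _ do rewrite mulrBl.
    rewrite sumrB cyc // sub0r; apply/eqP; rewrite oppr_eq0; apply/eqP.
    under eq_bigr => u _ do rewrite mulr_suml.
    rewrite exchange_big big1 //= => r rF.
    under eq_bigr => u _ do rewrite -mulrA.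
    by rewrite -mulr_sumr sum_faces_incidence // incidence_comp mulr0.
  rewrite (bigD1 s) //= big1 ?addr0 => [|u /andP[uF us]].
    move/(congr1 ( *%R^~ (inc s (s :\ v)))); rewrite mul0r -mulrA.
    by rewrite incidence_sqr ?subsetDl // mulr1 => /eqP; rewrite subr_eq0 => /eqP.
  have [vu|vu] := boolP (v \in u); last by rewrite g'0 // mul0r.
  rewrite incidence_eq0 ?mulr0 //; apply: contra us => /andP[tu _].
  rewrite eq_sym eqEcard.
  have -> : #|u| = #|s| by move: uF; rewrite inE sj => /andP[_ /eqP].
  by rewrite leqnn andbT -(setD1K vs) subUset sub1set vu.
move=> [|i]; apply/eqP; rewrite subn_eq0 /cycle_dim.
  rewrite -[X in (X <= _)%N](mxrank1 K); apply/mxrankS/rV_subP => w _.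
  have [g gE] := row_chain w.
  apply/submxP; exists (\row_a B g (enum_val a)); apply/rowP => a.
  rewrite gE (@mul_row_diff _ _ _ _ _ _ (B g)) => [|b]; last by rewrite mxE.
  by apply: main (enum_valP a).
apply/mxrankS/rV_subP => w /sub_kermxP wK.
have [g gE] := row_chain w.
apply/submxP; exists (\row_a B g (enum_val a)); apply/rowP => a.
rewrite gE (@mul_row_diff _ _ _ _ _ _ (B g)) => [|b]; last by rewrite mxE.
apply: main (enum_valP a) => t tF.
have /rowP/(_ (enum_rank_in tF t)) := wK.
by rewrite (mul_row_diff _ gE) mxE enum_rankK_in.
Qed.

End Acyclic.

(** * Stoss complexes *)

Section Stoss.
Variables (K : fieldType) (k : nat).
Implicit Types (s t V : {set 'I_k}) (X Delta : {set {set 'I_k}}).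

(** Exactness writes each face number as a sum of two consecutive ranks, so the low face numbers
    determine the ranks recursively; no faces above [p] means that the last rank is zero. *)
Lemma card_top_faces X q p :
    subset_closed X -> acyclic K X -> (0 < q)%N -> (0 < p)%N ->
    (forall i, (i < p)%N -> #|faces X i| = 'C(q, i)) -> faces X p.+1 = set0 ->
  #|faces X p| = 'C(q.-1, p.-1).
Proof.
case: q p => [//|q] [//|p] Xsub Xac _ _ low top /=.
pose D := diff (augmented_chain_complex K X).
(* From here [q] and [p] are one less than in the statement; the induction is Pascal's rule. *)
have rkD i : (i <= p)%N -> \rank (D i) = 'C(q, i).
  elim: i => [|i IHi] ip; first by rewrite -acyclic_rank0 // low // !bin0.
  apply: (@addnI (\rank (D i))).
  by rewrite -card_faces_rank // low // IHi ?(ltnW ip) // binS addnC.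
rewrite (card_faces_rank _ Xsub Xac) rkD //.
have /eqP -> : \rank (D p.+1) == 0%N; last by rewrite addn0.
by rewrite -leqn0; apply: leq_trans (rank_leq_row _) _; rewrite /= top cards0.
Qed.

Variables (Delta : {set {set 'I_k}}) (p : nat).
Hypothesis stoss : stoss_complex K Delta (p%:Z - 1).

Lemma stoss_closed : subset_closed Delta.
Proof. by case: stoss => -[]. Qed.

Lemma stoss_acyclic : acyclic K Delta.
Proof. by case: stoss. Qed.

Lemma stoss_low s : (#|s| < p)%N -> s \in Delta.
Proof. by case: stoss => _ _ low _ sp; apply: low; rewrite lerBrDr lez_nat addn1. Qed.

Lemma stoss_high s : s \in Delta -> (#|s| <= p)%N.
Proof.
case: stoss => _ /addIr [<-] _ _ sD.
exact: (@leq_bigmax_cond _ (mem Delta) (fun s => #|s|) s sD).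
Qed.

Lemma stoss_faces_high i : (p < i)%N -> faces Delta i = set0.
Proof.
move=> ip; apply/setP => s; rewrite !inE; apply/negbTE/negP => /andP[sD /eqP si].
by have := stoss_high sD; rewrite si leqNgt ip.
Qed.

(** For [p = 0] the empty set would be the only face, and it would span nonzero homology in degree
    0. *)
Lemma stoss_p_gt0 : (0 < p)%N.
Proof.
have := acyclic_rank0 stoss_acyclic.
have -> : faces Delta 0 = [set set0].
  apply/setP => s; rewrite !inE cards_eq0; case: eqP => [->|_]; rewrite ?andbF //.
  by case: stoss => -[-> _ _].
rewrite cards1; case: p stoss_faces_high => // H r1.
have := rank_leq_row (diff (augmented_chain_complex K Delta) 0); rewrite -r1.
by move/leq_trans/(_ (_ : _ <= 0)%N); apply; rewrite /= H // cards0.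
Qed.

Lemma stoss_card_restriction_low V i : (i < p)%N ->
  #|faces (restriction Delta V) i| = 'C(#|V|, i).
Proof.
move=> ip; rewrite -cards_draws; apply: eq_card => s; rewrite !inE.
by case: eqP => [si|_]; rewrite ?andbF // !andbT stoss_low // si.
Qed.

Lemma stoss_card_restriction_top V : V != set0 -> acyclic K (restriction Delta V) ->
  #|faces (restriction Delta V) p| = 'C(#|V|.-1, p.-1).
Proof.
move=> V0 Vac; apply: card_top_faces => //.
- exact/restriction_subset_closed/stoss_closed.
- by rewrite card_gt0.
- exact: stoss_p_gt0.
- by move=> i; apply: stoss_card_restriction_low.
apply/setP => s; rewrite !inE; apply/negbTE/negP => /andP[/andP[sD _] /eqP sp].
by have := stoss_high sD; rewrite sp ltnn.
Qed.

Lemma restrictionT X : restriction X [set: 'I_k] = X.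
Proof. by apply/setP => s; rewrite !inE subsetT andbT. Qed.

Lemma stoss_p_le_k : (p <= k)%N.
Proof.
case: stoss => _ /addIr [<-] _ _; apply/bigmax_leqP => s _.
by rewrite -[X in (_ <= X)%N]card_ord max_card.
Qed.

Lemma stoss_card_faces i : #|faces Delta i| =
  (if (i < p)%N then 'C(k, i) else if i == p then 'C(k.-1, i.-1) else 0%N).
Proof.
case: ltngtP => [ip|pi|->].
- by rewrite -(restrictionT Delta) stoss_card_restriction_low // cardsT card_ord.
- by rewrite stoss_faces_high // cards0.
rewrite -(restrictionT Delta) stoss_card_restriction_top ?cardsT ?card_ord //.
  by rewrite -card_gt0 cardsT card_ord (leq_trans stoss_p_gt0 stoss_p_le_k).
by rewrite restrictionT; apply: stoss_acyclic.
Qed.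

(** The restriction to a nonempty face is a full simplex, hence a cone over any of its vertices. *)
Lemma stoss_face_lattice s : s \in Delta -> acyclic_lattice K Delta s.
Proof.
have [->|/set0Pn[v vs] sD] := eqVneq s set0; first by left.
right; apply: (@acyclic_cone _ _ _ v).
  exact/restriction_subset_closed/stoss_closed.
move=> t; rewrite !inE => /andP[_ ts]; rewrite subUset sub1set vs ts !andbT.
by apply: (stoss_closed sD); rewrite subUset sub1set vs ts.
Qed.

(** For a nonface with q elements, count pairs of a vertex [v] in [s] and a p-face of [s] avoiding
    it. The deletions give [q * 'C(q-2, p-1)], the faces give [(q-p) * 'C(q-1, p-1) = (q-1) *
    'C(q-2, p-1)], and the binomial is positive when [p < q]. *)
Lemma stoss_all_deletions s : acyclic_lattice K Delta s ->
  (forall v, v \in s -> acyclic_lattice K Delta (s :\ v)) -> s \in Delta.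
Proof.
case=> [->|sac] del; first by case: stoss => -[].
apply/negPn/negP => sD.
have ps : (p <= #|s|)%N by rewrite leqNgt; apply: contra sD => /stoss_low.
have s0 : s != set0 by rewrite -card_gt0 (leq_trans stoss_p_gt0).
have top := stoss_card_restriction_top s0 sac.
(* If [#|s| = p], the restriction has exactly one p-face, which must be [s] itself. *)
have [sp|sp] := leqP #|s| p.
  have {}sp : #|s| = p by apply/eqP; rewrite eqn_leq sp ps.
  move: top; rewrite sp binn => /eqP/cards1P[F FE].
  have : F \in faces (restriction Delta s) p by rewrite FE set11.
  rewrite !inE => /andP[/andP[FD Fs] /eqP Fp].
  suff FsE : F = s by rewrite -FsE FD in sD.
  by apply/eqP; rewrite eqEcard Fs sp Fp leqnn.
have s_gt1 : (1 < #|s|)%N by apply: leq_ltn_trans sp; apply: stoss_p_gt0.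
have cardD v : v \in s -> #|s :\ v| = #|s|.-1 by move=> vs; rewrite (cardsD1 v s) vs.
have count : (\sum_(v in s) #|faces (restriction Delta (s :\ v)) p|
    = (#|s| - p) * 'C(#|s|.-1, p.-1))%N.
  transitivity (\sum_(v in s) \sum_(F in faces (restriction Delta s) p) (v \notin F))%N.
    apply: eq_bigr => v vs; rewrite -sum1_card big_mkcond [RHS]big_mkcond /=.
    apply: eq_bigr => F _; rewrite !inE subsetD1.
    by case: (_ \in Delta); case: (_ \subset _); case: (_ == p); case: (v \in F).
  rewrite exchange_big /= -top mulnC -sum_nat_const.
  apply: eq_bigr => F; rewrite !inE => /andP[/andP[_ Fs] /eqP <-].
  rewrite -[in RHS](setIidPr Fs) -cardsD -sum1_card [RHS]big_mkcond [LHS]big_mkcond /=.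
  by apply: eq_bigr => v _; rewrite !inE; case: (v \in s); case: (v \in F).
have : (#|s| * 'C(#|s|.-2, p.-1) = #|s|.-1 * 'C(#|s|.-2, p.-1))%N.
  rewrite -[#|s|.-2]/(#|s|.-1.-1) [RHS]mul_bin_down.
  have -> : (#|s|.-1 - p.-1 = #|s| - p)%N.
    by case: #|s| s_gt1 => // q _; case: p stoss_p_gt0.
  rewrite -count -sum_nat_const; apply: eq_bigr => v vs.
  have sv0 : s :\ v != set0.
    by rewrite -card_gt0 cardD // -ltnS prednK // ltnW.
  have [/eqP|svac] := del v vs; first by rewrite (negbTE sv0).
  by rewrite stoss_card_restriction_top // cardD.
move/eqP; rewrite eqn_mul2r => /orP[|/eqP]; last first.
  by move/eqP; rewrite eq_sym; case: #|s| s_gt1 => //= q _; rewrite ltn_eqF.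
rewrite -leqn0 leqNgt bin_gt0.
by case: #|s| s_gt1 sp => [|[|q]] //= _; case: p stoss_p_gt0 => //= q' _ lt_q; have -> : (q' <= q)%N by [].
Qed.

End Stoss.

(** * The lcm lattice *)

Section Labels.
Variables (n k : nat) (m : 'I_k -> 'X_{1..n}).
Implicit Types (s t : {set 'I_k}) (u g : 'X_{1..n}).

Lemma lem_anti u g : (u <= g)%MM -> (g <= u)%MM -> u = g.
Proof.
move=> /mnm_lepP ug /mnm_lepP gu; apply/mnmP => i.
by apply/eqP; rewrite eqn_leq ug gu.
Qed.

Lemma le0m u : (0 <= u)%MM.
Proof. by apply/mnm_lepP => i; rewrite mnm0E. Qed.

Lemma big_mlcm_le (T : Type) (r : seq T) (P : pred T) (F : T -> 'X_{1..n}) u :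
  (\big[@mlcm n/0%MM]_(i <- r | P i) F i <= u)%MM
    = all (fun i => P i ==> (F i <= u)%MM) r.
Proof.
elim: r => [|i r IHr]; first by rewrite big_nil le0m.
by rewrite big_cons /=; case: (P i); rewrite // lem_mlcm IHr.
Qed.

Lemma label_leP s u :
  reflect (forall v, v \in s -> (m v <= u)%MM) (label m s <= u)%MM.
Proof.
rewrite /label big_mlcm_le; apply: (iffP allP) => [H v vs|H v _].
  by have := H v (mem_index_enum v); rewrite vs.
by apply/implyP/H.
Qed.

Lemma label_ge s v : v \in s -> (m v <= label m s)%MM.
Proof. by move=> vs; apply: (label_leP s _ (lepm_refl _)). Qed.

Lemma label_sub s t : t \subset s -> (label m t <= label m s)%MM.
Proof. by move=> /subsetP ts; apply/label_leP => v /ts; apply: label_ge. Qed.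

Lemma label0 : label m set0 = 0%MM.
Proof. by rewrite /label big_set0. Qed.

Lemma label1 v : label m [set v] = m v.
Proof.
by apply: lem_anti; [apply/label_leP => w /set1P -> | rewrite label_ge ?set11];
  rewrite ?lepm_refl.
Qed.

End Labels.

(** * Translating the lattice isomorphism into divisibility of labels *)

Section Lattice.
Variables (K : fieldType) (n k p : nat) (I : {pred {mpoly K[n]}}).
Variables (Delta : {set {set 'I_k}}) (f : {set 'I_k} -> 'X_{1..n}).
Hypothesis hI : monomial_ideal I.
Hypothesis hDelta : stoss_complex K Delta (p%:Z - 1).
Hypothesis hf : lattice_isomorphism Delta I f.
Implicit Types (s t V W : {set 'I_k}) (u g h : 'X_{1..n}).

Let m v := f [set v].
Local Notation L := (acyclic_lattice K Delta).

Let f_le V W : L V -> L W -> (f V <= f W)%MM = (V \subset W).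
Proof. by case: hf => _ _; apply. Qed.

Let I_ideal : idealr_closed I. Proof. by case: hI. Qed.

Let L0 : L set0. Proof. by left. Qed.

Let L1 v : L [set v].
Proof. by apply: (stoss_face_lattice hDelta); case: hDelta => -[_ H _]. Qed.

Lemma lattice_map_set0 : f set0 = 0%MM.
Proof.
case: hf => _ f_surj _.
have [V LV fV] : exists2 V, L V & f V = 0%MM.
  by apply: f_surj; exists [::]; rewrite ?big_nil.
by apply: lem_anti (le0m _); rewrite -fV f_le // sub0set.
Qed.

Lemma minimal_generator_neq0 g : minimal_generator I g -> g <> 0%MM.
Proof. by case=> gI _ g0; case: I_ideal => _ + _; rewrite -(@mpolyX0 n K) -g0 gI. Qed.

(** The element [f [set v]] is not the bottom, so some minimal generator g divides it. Writing
    [g = f W] gives W inside [[set v]], and W is nonempty because [I] is proper. *)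
Lemma atom_minimal_generator v : minimal_generator I (m v).
Proof.
case: hf => f_lcm f_surj _.
have [r rgen fr] := f_lcm _ (L1 v).
case: r => [|g r] in rgen fr.
  have := f_le (L1 v) L0; rewrite fr big_nil lattice_map_set0 lepm_refl.
  by move/esym; rewrite sub1set inE.
have gmin : minimal_generator I g by apply: rgen; rewrite mem_head.
have gv : (g <= m v)%MM.
  by have := lepm_refl (m v); rewrite {1}/m fr big_mlcm_le /= => /andP[].
have [W LW fW] : exists2 W, L W & f W = g.
  apply: f_surj; exists [:: g] => [h|]; first by rewrite inE => /eqP ->.
  by rewrite big_cons big_nil mlcm0.
have := gv; rewrite -fW f_le // subset1 => /orP[/eqP Wv|/eqP W0].
  by rewrite /m -Wv fW.
by case: (minimal_generator_neq0 gmin); rewrite -fW W0 lattice_map_set0.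
Qed.

(** Write [g = f W] with W nonempty: for any v in W, [m v] divides g and lies in [I], so minimality
    forces equality. *)
Lemma minimal_generator_atom g : minimal_generator I g -> exists v, g = m v.
Proof.
move=> gmin; case: hf => _ f_surj _.
have [W LW fW] : exists2 W, L W & f W = g.
  apply: f_surj; exists [:: g] => [h|]; first by rewrite inE => /eqP ->.
  by rewrite big_cons big_nil mlcm0.
have [W0|/set0Pn[v vW]] := eqVneq W set0.
  by case: (minimal_generator_neq0 gmin); rewrite -fW W0 lattice_map_set0.
exists v; apply/esym; case: gmin => _; apply.
  by rewrite -fW f_le // sub1set.
by case: (atom_minimal_generator v).
Qed.

Lemma atoms_enumerate : enumerates_minimal_generators I m.
Proof.
split=> [v w mvw|g].
  have := f_le (L1 v) (L1 w); rewrite -/(m v) mvw lepm_refl => /esym.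
  by rewrite sub1set inE => /eqP.
split=> [|[v ->]]; first exact: minimal_generator_atom.
exact: atom_minimal_generator.
Qed.

Lemma lattice_map_label V : L V -> f V = label m V.
Proof.
move=> LV; apply: lem_anti; last first.
  by apply/label_leP => v vV; rewrite f_le // sub1set.
case: hf => f_lcm _ _; have [r rgen fr] := f_lcm _ LV.
rewrite [X in (X <= _)%MM]fr big_mlcm_le; apply/allP => g gr /=.
have [v gv] := minimal_generator_atom (rgen g gr).
rewrite gv; apply: label_ge; rewrite -sub1set -f_le // -/(m v) -gv fr.
have := lepm_refl (\big[@mlcm n/0%MM]_(g <- r) g); rewrite big_mlcm_le => /allP.
by move/(_ g gr).
Qed.

(** The lcm of the atoms below [u] is [f W] for some W in the lattice. Then v lies in W iff [m v]
    divides this lcm, which happens iff [m v] divides [u], so the set is W. *)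
Lemma atoms_below_lattice u : L [set v | (m v <= u)%MM].
Proof.
set V := [set v | _]; case: hf => _ f_surj _.
have [W LW fW] : exists2 W, L W & f W = label m V.
  apply: f_surj; exists [seq m v | v <- index_enum _ & v \in V].
    by move=> g /mapP[v _ ->]; apply: atom_minimal_generator.
  by rewrite big_map big_filter.
suff -> : V = W by [].
apply/setP => v; rewrite -[RHS]sub1set -(f_le (L1 v) LW) fW.
apply/idP/idP => [vV|vV]; first exact: (label_ge m vV).
rewrite /V inE.
by apply: lepm_trans vV _; apply/label_leP => w; rewrite /V inE.
Qed.

Lemma label_inj_lattice s t : L s -> L t -> label m s = label m t -> s = t.
Proof.
move=> Ls Lt st; apply/eqP; rewrite eqEsubset -!f_le //.
by rewrite !lattice_map_label // st lepm_refl.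
Qed.

Lemma label_closure s : label m [set v | (m v <= label m s)%MM] = label m s.
Proof.
apply: lem_anti; first by apply/label_leP => v; rewrite inE.
by apply: label_sub; apply/subsetP => v vs; rewrite inE label_ge.
Qed.

Lemma label_face_lt s t : s \in Delta -> t \proper s -> label m s <> label m t.
Proof.
move=> sD /properP[ts [v vs /negP vt]] st; apply: vt.
have Ls := stoss_face_lattice hDelta sD.
have Lt := stoss_face_lattice hDelta (stoss_closed hDelta sD ts).
by rewrite -(label_inj_lattice Ls Lt st).
Qed.

Lemma scarf_complexE : scarf_complex m = Delta.
Proof.
apply/setP => s; rewrite inE; apply/forallP/idP => [scarf|sD t].
  have uniq_s t : label m t = label m s -> t = s.
    by move=> ts; have /implyP/(_ _)/eqP -> // := scarf t; rewrite ts.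
  (* A Scarf face is alone with its label, so it equals the set of all atoms dividing that label. *)
  have sE := uniq_s _ (label_closure s).
  have Ls : L s by rewrite -sE; apply: atoms_below_lattice.
  apply: (stoss_all_deletions hDelta Ls) => v vs.
  set t := s :\ v; set W := [set w | (m w <= label m t)%MM].
  have tW : t \subset W by apply/subsetP => w wt; rewrite inE label_ge.
  have Ws : W \subset s.
    rewrite -sE; apply/subsetP => w; rewrite !inE => /lepm_trans; apply.
    by apply: label_sub; rewrite subsetDl.
  (* The closure W of [s :\ v] lies between [s :\ v] and [s]; if it were [s], then [s] and [s :\ v]
     would share a label. *)
  suff -> : t = W by apply: atoms_below_lattice.
  apply/eqP; rewrite eqEsubset tW subsetD1 Ws; apply/negP => vW.
  have WE : W = s.
    by apply/eqP; rewrite eqEsubset Ws -(setD1K vs) subUset sub1set vW.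
  have /uniq_s tE : label m t = label m s by rewrite -label_closure -/W WE.
  by move: vs; rewrite -{1}tE !inE eqxx.
apply/implyP => /eqP st; apply/eqP.
have Ls := stoss_face_lattice hDelta sD.
(* Every atom of [t] divides the label of [s], which is [f s]. So [t] is a face too, and labels are
   injective on the lattice. *)
have ts : t \subset s.
  apply/subsetP => v vt; rewrite -sub1set -f_le // (lattice_map_label Ls) st.
  exact: (label_ge m vt).
by apply: (label_inj_lattice Ls) st; apply/(stoss_face_lattice hDelta)/(stoss_closed hDelta sD).
Qed.

End Lattice.

(** * The complex supported on Delta *)

Lemma mcoeffMX_out (n : nat) (R : nzRingType) (q : {mpoly R[n]}) (a w : 'X_{1..n}) :
  ~~ (a <= w)%MM -> (q * 'X_[a])@_w = 0.
Proof.
move=> naw; apply/eqP; rewrite mcoeff_eq0 (perm_mem (msuppMX q a)).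
apply: contra naw => /mapP[w' _ ->]; exact: lem_addr.
Qed.

Lemma incidence_mpolyC (K : fieldType) (n k : nat) (s t : {set 'I_k}) :
  @incidence k {mpoly K[n]} s t = (incidence K s t)%:MP.
Proof.
by rewrite /incidence; case: ifP => _; rewrite ?mpolyC0 // rmorphXn rmorphN1.
Qed.

(** Descent on the degree: a non-minimal monomial of [I] has a proper divisor in [I]. *)
Lemma minimal_generator_exists (K : fieldType) (n : nat) (I : {pred {mpoly K[n]}}) u :
  'X_[u] \in I -> exists2 g, minimal_generator I g & (g <= u)%MM.
Proof.
have [d] := ubnP (mdeg u); elim: d u => // d IHd u ud uI.
have [umin|nmin] := classic (minimal_generator I u); first by exists u; rewrite ?lepm_refl.
have [h [hu hI hnu]] : exists h, [/\ (h <= u)%MM, 'X_[h] \in I & h <> u].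
  apply: NNPP => none; apply: nmin; split=> // h hu hI.
  by apply: NNPP => hnu; apply: none; exists h.
have [|g gmin gh] := IHd h _ hI; last by exists g => //; apply: lepm_trans gh hu.
rewrite -ltnS; apply: leq_trans ud; rewrite ltnS -(submK hu) mdegD -[X in (X < _)%N]add0n.
rewrite ltn_add2r lt0n mdeg_eq0; apply/eqP => uh; apply: hnu.
by rewrite -(submK hu) uh add0m.
Qed.

Section SupportedComplex.
Variables (K : fieldType) (n k : nat) (m : 'I_k -> 'X_{1..n}).
Variable Delta : {set {set 'I_k}}.
Hypothesis Delta_closed : subset_closed Delta.
Local Notation S := {mpoly K[n]}.
Local Notation lab := (label m).
Local Notation c := (fun s t => @incidence k S s t * 'X_[(label m s - label m t)%MM]).
Implicit Types (s t r V : {set 'I_k}) (u w : 'X_{1..n}).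
Local Notation below u := [set v | (m v <= u)%MM].

Lemma label_le_below s u : (lab s <= u)%MM = (s \subset below u).
Proof.
apply/label_leP/subsetP => H v vs; first by rewrite inE H.
by have := H v vs; rewrite inE.
Qed.

(** Label differences telescope, leaving a monomial independent of [s]; hence the square of the
    differential vanishes as for the simplicial boundary. *)
Lemma supported_mul r s t :
  c r s * c s t = @incidence k S r s * @incidence k S s t * 'X_[(lab r - lab t)%MM].
Proof.
have [/andP[sr _]|H] := boolP ((s \subset r) && (#|r| == #|s|.+1));
  last by rewrite (incidence_eq0 _ H) !mul0r.
have [/andP[ts _]|H] := boolP ((t \subset s) && (#|s| == #|t|.+1));
  last by rewrite (incidence_eq0 _ H) !(mulr0, mul0r).
rewrite mulrACA -mpolyXD addmBA ?label_sub // submK ?label_sub //.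
Qed.

Lemma supported_comp0 i r t : r \in faces Delta i.+1 ->
  \sum_(s in faces Delta i) c r s * c s t = 0.
Proof.
move=> rF; under eq_bigr => s _ do rewrite supported_mul.
by rewrite -mulr_suml sum_faces_incidence // incidence_comp mul0r.
Qed.

(** The strand in multidegree [u]: the basis element of [s] has multidegree [lab s]. Subtraction of
    exponents is truncated, hence the explicit 0 when [lab s] does not divide [x^u]. *)
Definition degree_part u (g : {set 'I_k} -> S) s : K :=
  if (lab s <= u)%MM then (g s)@_(u - lab s) else 0.

Lemma sum_restriction (R : nzRingType) V i (F : {set 'I_k} -> R) :
  \sum_(s in faces (restriction Delta V) i) F s
    = \sum_(s in faces Delta i | s \subset V) F s.
Proof. by apply: eq_bigl => s; rewrite !inE andbAC. Qed.

(** Compare coefficients of [x^(u - lab t)]: a face whose label does not divide [x^u] contributes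
    nothing to it. *)
Lemma degree_part_cycle u g i t : (lab t <= u)%MM ->
    \sum_(s in faces Delta i) g s * c s t = 0 ->
  \sum_(s in faces (restriction Delta (below u)) i)
     degree_part u g s * incidence K s t = 0.
Proof.
move=> tu /(congr1 (mcoeff (u - lab t)%MM)); rewrite mcoeff0 raddf_sum /= => cyc; rewrite -[RHS]cyc.
rewrite sum_restriction big_mkcondr; apply: eq_bigr => s _.
rewrite -label_le_below /degree_part.
have [/andP[ts _]|H] := boolP ((t \subset s) && (#|s| == #|t|.+1)); last first.
  by rewrite !(incidence_eq0 _ H) !(mulr0, mul0r) mcoeff0; case: ifP.
have tsl := label_sub m ts.
rewrite incidence_mpolyC mulrCA mcoeffCM mulrC; case: ifPn => su.
  have -> : (u - lab t = lab s - lab t + (u - lab s))%MM.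
    by rewrite addmC addmBA // submK.
  by rewrite mcoeffMX su.
rewrite mcoeffMX_out ?mulr0 //; apply: contra su => H.
rewrite -(submK tsl) -(submK tu); apply/mnm_lepP => j.
by rewrite !mnmDE leq_add2r; have /mnm_lepP := H; apply.
Qed.

Hypothesis below_acyclic : forall u, acyclic_lattice K Delta (below u).

Lemma degree_part_boundary u g i :
    (forall t, t \in faces Delta i -> \sum_(s in faces Delta i.+1) g s * c s t = 0) ->
  exists y, forall s, s \in faces Delta i.+1 ->
    degree_part u g s *: 'X_[(u - lab s)%MM] = \sum_(r in faces Delta i.+2) y r * c r s.
Proof.
move=> cyc.
have Vsub := restriction_subset_closed (V := below u) Delta_closed.
have [b bE] : exists b : {set 'I_k} -> K, forall s,
    s \in faces (restriction Delta (below u)) i.+1 ->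
    degree_part u g s = \sum_(r in faces (restriction Delta (below u)) i.+2)
      b r * incidence K r s.
  (* If no atom divides [x^u], the restriction has no faces in positive degree and the claim is
     vacuous. *)
  case: (below_acyclic u) => [->|ac].
    exists (fun=> 0) => s; rewrite !inE subset0 => /andP[/andP[_ /eqP->]].
    by rewrite cards0.
  apply: acyclic_exact => // t; rewrite !inE -label_le_below => /andP[/andP[tD tu] ti].
  by apply: degree_part_cycle => //; apply: cyc; rewrite inE tD.
exists (fun r => if (lab r <= u)%MM then b r *: 'X_[(u - lab r)%MM] else 0) => s sF.
transitivity ((\sum_(r in faces (restriction Delta (below u)) i.+2)
    b r * incidence K r s) *: 'X_[K, (u - lab s)%MM]).
  have [su|su] := boolP (lab s <= u)%MM.
    rewrite bE //; move: sF; rewrite !inE -label_le_below su => /andP[-> ->] //.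
  rewrite /degree_part (negbTE su) scale0r big1 ?scale0r // => r.
  rewrite !inE -label_le_below => /andP[/andP[_ ru] _].
  rewrite incidence_eq0 ?mulr0 //; apply: contra su => /andP[sr _].
  by apply: lepm_trans ru; apply: label_sub.
rewrite sum_restriction big_mkcondr scaler_suml; apply: eq_bigr => r _.
rewrite -label_le_below; case: ifP => ru; last by rewrite scale0r mul0r.
have [/andP[sr _]|H] := boolP ((s \subset r) && (#|r| == #|s|.+1)); last first.
  by rewrite !(incidence_eq0 _ H) mulr0 scale0r mul0r mulr0.
rewrite incidence_mpolyC mul_mpolyC -scalerAr -scalerAl -mpolyXD scalerA mulrC.
by rewrite addmBA ?label_sub // submK.
Qed.

Lemma degree_parts_sum (U : seq 'X_{1..n}) g s :
    uniq U -> (forall w, w \in msupp (g s) -> (lab s + w)%MM \in U) ->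
  g s = \sum_(u <- U) degree_part u g s *: 'X_[(u - lab s)%MM].
Proof.
move=> Uuniq UP; apply/mpolyP => w; rewrite raddf_sum /=.
have vanish u : u != (lab s + w)%MM ->
    (degree_part u g s *: 'X_[K, (u - lab s)%MM])@_w = 0.
  move=> uw; rewrite /degree_part; case: ifP => su; last by rewrite scale0r mcoeff0.
  rewrite mcoeffZ mcoeffX; case: eqP => [wE|]; rewrite ?mulr0 //.
  by case/eqP: uw; rewrite -wE addmC submK.
have at_w : (degree_part (lab s + w)%MM g s *: 'X_[K, (lab s + w - lab s)%MM])@_w = (g s)@_w.
  by rewrite /degree_part lem_addr addmC addmK mcoeffZ mcoeffX eqxx mulr1.
have [wU|wU] := boolP ((lab s + w)%MM \in U).
  by rewrite (bigD1_seq _ wU Uuniq) //= at_w big1 ?addr0.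
have -> : (g s)@_w = 0 by apply/eqP; rewrite mcoeff_eq0; apply: contra wU => /UP.
rewrite big_seq big1 // => u uU; apply: vanish.
by apply: contra wU => /eqP <-.
Qed.

Lemma supported_exact i g :
    (forall t, t \in faces Delta i -> \sum_(s in faces Delta i.+1) g s * c s t = 0) ->
  exists y, forall s, s \in faces Delta i.+1 ->
    g s = \sum_(r in faces Delta i.+2) y r * c r s.
Proof.
move=> cyc.
(* All multidegrees occurring in [g]. Boundaries found for the single degrees are then added up by
   induction on this list. *)
pose U := undup (flatten [seq [seq (lab s + w)%MM | w <- msupp (g s)] | s <- enum {set 'I_k}]).
have UP s w : w \in msupp (g s) -> (lab s + w)%MM \in U.
  move=> ws; rewrite mem_undup; apply/flattenP; eexists; last exact: map_f ws.
  by apply/mapP; exists s => //; rewrite mem_enum.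
have : exists y, forall s, s \in faces Delta i.+1 ->
    \sum_(u <- U) degree_part u g s *: 'X_[(u - lab s)%MM]
      = \sum_(r in faces Delta i.+2) y r * c r s.
  elim: U {UP} => [|u U [y yE]].
    exists (fun=> 0) => s _; rewrite big_nil big1 // => r _; exact: mul0r.
  have [y' y'E] := degree_part_boundary u cyc.
  exists (fun r => y' r + y r) => s sF; rewrite big_cons y'E // yE // -big_split /=.
  by apply: eq_bigr => r _; rewrite mulrDl.
case=> y yE; exists y => s sF; rewrite -yE //.
by apply: degree_parts_sum (undup_uniq _) _ => w; apply: UP.
Qed.

Variable I : {pred S}.
Hypothesis hI : monomial_ideal I.
Hypothesis m_gen : forall g, minimal_generator I g <-> exists v, g = m v.
Hypothesis Delta_vertices : forall v, [set v] \in Delta.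
Hypothesis Delta0 : set0 \in Delta.

Lemma faces0 : faces Delta 0 = [set set0].
Proof.
by apply/setP => s; rewrite !inE cards_eq0; case: eqP => [->|_]; rewrite ?Delta0 ?andbF.
Qed.

(** Each monomial of [I] is a multiple of some [m v], the image up to sign of the basis element of
    the vertex v. *)
Lemma ideal_boundary q : q \in I ->
  exists y, q = \sum_(s in faces Delta 1) y s * c s set0.
Proof.
have [I_ideal _ [G IG]] := hI.
move=> /IG[r rG ->] {q}; elim: r rG => [|[q u] r IHr] rG.
  by exists (fun=> 0); rewrite big_nil big1 // => s _; rewrite mul0r.
have [|y yE] := IHr; first by move=> t tr; apply: rG; rewrite inE tr orbT.
have uI : 'X_[u] \in I.
  apply/IG; exists [:: (1, u)]; last by rewrite big_seq1 mul1r.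
  by move=> t; rewrite inE => /eqP ->; apply: (rG (q, u)); rewrite mem_head.
have [_ /m_gen[v ->] vu] := minimal_generator_exists uI.
(* The incidence factor is included so that it squares to 1 against the one in the differential. *)
pose y' s := if s == [set v] then q * 'X_[(u - m v)%MM] * @incidence k S s set0 else 0.
exists (fun s => y' s + y s); rewrite big_cons yE.
under [RHS]eq_bigr => s _ do rewrite mulrDl.
rewrite big_split /=; congr (_ + _).
rewrite (bigD1 [set v]) /=; last by rewrite inE Delta_vertices cards1.
rewrite big1 ?addr0 => [|s /andP[_ /negbTE sv]]; last by rewrite /y' sv mul0r.
rewrite /y' eqxx label0 label1 subm0.
have := @incidence_sqr k S [set v] set0 (sub0set _).
rewrite cards1 cards0 => /(_ erefl) sqr1.
by rewrite -[RHS]mulrA [X in _ = _ * X]mulrA sqr1 mul1r -mulrA -mpolyXD submK.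
Qed.

Lemma boundary_ideal y : \sum_(s in faces Delta 1) y s * c s set0 \in I.
Proof.
have [I_ideal _ _] := hI.
elim/big_ind: _ => [|q r|s]; [exact: ideal0 | exact: idealD | ].
rewrite inE => /andP[_ /cards1P[v ->]]; rewrite mulrA label1 label0 subm0.
by apply: idealM => //; have /m_gen[] : exists v0, m v = m v0 by exists v.
Qed.

Lemma supported_free_resolution :
  @free_resolution K n I (supported_complex K m Delta) (const_mx 1).
Proof.
(* The empty set is the only face in degree 0, so the module there is S and the augmentation
   [const_mx 1] is the identity. *)
have eE (x : 'rV[S]_#|faces Delta 0|) g : (forall a, x 0 a = g (enum_val a)) ->
    (x *m const_mx 1 : 'M_1) 0 0 = g set0.
  move=> gE; rewrite mxE; under eq_bigr => a _ do rewrite mxE mulr1 gE.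
  by rewrite -(big_enum_val g) faces0 big_set1.
have faces0P (b : 'I_#|faces Delta 0|) : enum_val b = set0.
  by have := enum_valP b; rewrite inE cards_eq0 => /andP[_ /eqP].
have dE (y : 'rV[S]_#|faces Delta 1|) h : (forall a, y 0 a = h (enum_val a)) ->
    (y *m diff (supported_complex K m Delta) 0 *m const_mx 1 : 'M_1) 0 0
      = \sum_(s in faces Delta 1) h s * c s set0.
  move=> hE; rewrite (eE _ (fun t => \sum_(s in faces Delta 1) h s * c s t)) //.
  by move=> b; rewrite (mul_row_diff b hE).
split.
- split=> [a x y|i a x y]; last by rewrite mulmxDl scalemxAl.
  by rewrite mulmxDl -scalemxAl !mxE.
- move=> q; exists (const_mx q); rewrite (eE _ (fun=> q)) => [|a]; last by rewrite mxE.
  by rewrite subrr; case: hI => -[].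
- move=> x; have [g gE] := row_chain x; split=> [|[y ->]].
    rewrite (eE _ _ gE) => /ideal_boundary[y yE].
    exists (\row_a y (enum_val a)); apply/rowP => b; rewrite gE.
    rewrite (@mul_row_diff _ _ _ _ _ _ y) => [|a]; last by rewrite mxE.
    by rewrite faces0P.
  have [h hE] := row_chain y; rewrite (dE _ _ hE); exact: boundary_ideal.
- move=> i x; split=> [xd0|[y ->]]; last first.
    rewrite -mulmxA face_complex_comp0 ?mulmx0 // => r t rF _.
    exact: supported_comp0.
  have [g gE] := row_chain x.
  have [t tF|y yE] := @supported_exact i g.
    have /rowP/(_ (enum_rank_in tF t)) := xd0.
    by rewrite (mul_row_diff _ gE) mxE enum_rankK_in.
  exists (\row_a y (enum_val a)); apply/rowP => b; rewrite gE yE ?enum_valP //.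
  by rewrite (@mul_row_diff _ _ _ _ _ _ y) => [|a]; last by rewrite mxE.
Qed.

(** A nonzero entry is a signed monomial in the label difference, which is constant only when the
    two labels agree. *)
Lemma supported_minimal :
    (forall s t, s \in Delta -> t \proper s -> label m s <> label m t) ->
  minimal_complex (supported_complex K m Delta).
Proof.
move=> lab_lt i a b; rewrite mxE.
set s := enum_val a; set t := enum_val b.
have [/andP[ts /eqP st]|H] := boolP ((t \subset s) && (#|s| == #|t|.+1)); last first.
  by rewrite (incidence_eq0 _ H) mul0r mcoeff0.
rewrite incidence_mpolyC mcoeffCM mcoeffX; case: eqP => [E|]; rewrite ?mulr0 //.
case: (lab_lt s t).
- by have := enum_valP a; rewrite inE => /andP[].
- by rewrite properEcard ts st leqnn.
- by rewrite -(submK (label_sub m ts)) E add0m.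
Qed.

End SupportedComplex.

Theorem theorem1p3 (K : fieldType) (n : nat) (I : {pred {mpoly K[n]}})
  (k p : nat) (Delta : {set {set 'I_k}}) (f : {set 'I_k} -> 'X_{1..n})
  (hI : monomial_ideal I)
  (hDelta : stoss_complex K Delta (p%:Z - 1))
  (hf : lattice_isomorphism Delta I f) :
  let m := fun v : 'I_k => f [set v] in
  [/\ enumerates_minimal_generators I m,
      scarf_complex m = Delta,
      @free_resolution K n I (supported_complex K m Delta) (const_mx 1)
        /\ minimal_complex (supported_complex K m Delta),
      has_projdim I p
    & forall i : nat,
        has_betti_number I i
          (if (i < p)%N then 'C(k, i)
           else if i == p then 'C(k.-1, i.-1)
           else 0%N)].
Proof.
move=> m.
have [[D0 D1 _] _ _ _] := hDelta.
have I_ideal : idealr_closed I by case: hI.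
have enum_m := atoms_enumerate hI hDelta hf.
have res : @free_resolution K n I (supported_complex K m Delta) (const_mx 1).
  apply: supported_free_resolution D1 D0 => //.
  - exact: stoss_closed hDelta.
  - by move=> u; apply: atoms_below_lattice hI hDelta hf u.
  - by case: enum_m.
have minimal : minimal_complex (supported_complex K m Delta).
  by apply: supported_minimal => s t; apply: label_face_lt hI hDelta hf s t.
have rkE := stoss_card_faces hDelta.
split=> //; first exact: scarf_complexE hI hDelta hf.
- apply: (projdim_minimal I_ideal res minimal) => [|i pi]; rewrite /= rkE.
    (* The module in degree [p] is nonzero because [p <= k]. *)
    by rewrite ltnn eqxx bin_gt0 -!subn1 leq_sub2r // (stoss_p_le_k hDelta).
  by rewrite ltnNge (ltnW pi) /= gtn_eqF.
- by move=> i; rewrite -rkE; exact: (betti_minimal I_ideal i res minimal).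
Qed.
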